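(* Let $S\subset\mathbb{R}^2$ be a Minkowski-centered triangle. The diagram $f_{\mathrm{HM}}(\bar{\mathcal{C}}^2,S)$ is fully described by the inequalities $$D_{\mathrm{HM}}(K,S)\le 3R(K,S),\qquad 3r(K,S)\le D_{\mathrm{HM}}(K,S),\qquad 0\le r(K,S),\qquad R(K,S)\le\tfrac23 D_{\mathrm{HM}}(K,S),$$ $$\frac49\left(\frac{D_{\mathrm{HM}}(K,S)}{R(K,S)}-\frac34\right)\left(\frac94-\frac{D_{\mathrm{HM}}(K,S)}{R(K,S)}\right)\le\frac{r(K,S)}{R(K,S)}.$$ That is, $$f_{\mathrm{HM}}(\bar{\mathcal{C}}^2,S)=\left\{(x,y)\in\mathbb{R}^2:\ 2y\le 3,\ 3x\le 2y,\ 0\le x,\ 1\le\tfrac43 y,\ \tfrac49\left(2y-\tfrac34\right)\left(\tfrac94-2y\right)\le x\right\}.$$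
   Context: A convex body is a nonempty compact convex set. $\bar{\mathcal{C}}^2$ is the family of convex bodies in $\mathbb{R}^2$ that are not single points. For a convex body $C$ with $0$ in its interior, $\|x\|_C=\min\{\lambda\ge0:x\in\lambda C\}$ is the gauge function. For convex bodies $K,C$: the circumradius is $R(K,C)=\inf\{\rho\ge0:\exists t,\ K\subset t+\rho C\}$ and the inradius is $r(K,C)=\sup\{\rho\ge0:\exists t,\ t+\rho C\subset K\}$. The Minkowski asymmetry is $s(C)=R(C,-C)$, and $C$ is Minkowski-centered if $C\subset -s(C)C$. (Triangles are understood to be full-dimensional; a Minkowski-centered triangle contains $0$ in its interior.) The harmonic diameter is $$D_{\mathrm{HM}}(K,C)=\max_{x,y\in K}\tfrac12\left(\|x-y\|_C+\|x-y\|_{-C}\right).$$ For $K\in\bar{\mathcal{C}}^2$, $f_{\mathrm{HM}}(K,C)=\left(\frac{r(K,C)}{R(K,C)},\frac{D_{\mathrm{HM}}(K,C)}{2R(K,C)}\right)$, and $f_{\mathrm{HM}}(\bar{\mathcal{C}}^2,C)=\{f_{\mathrm{HM}}(K,C):K\in\bar{\mathcal{C}}^2\}$ is the Blaschke-Santaló diagram. ''Fully described'' by inequalities means that every $K$ satisfies them and every pair of values satisfying them is attained by some $K$. *)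

(* Defs.v *)
From HB Require Import structures.
From mathcomp Require Import all_boot all_order all_algebra.
From mathcomp Require Import all_classical all_reals all_analysis.

Set Implicit Arguments.
Unset Strict Implicit.
Unset Printing Implicit Defensive.

Import Order.TTheory GRing.Theory Num.Theory.
Import numFieldNormedType.Exports.

Local Open Scope classical_set_scope.
Local Open Scope ring_scope.

(* [inf] and [sup] on [R] are total and only meaningful for nonempty sets that
   are bounded on the relevant side. If [0 < n], [K] and [C] are convex bodies and [0] is
   in the interior of [C], all the sets below are of this kind; moreover the
   infimum in [gauge] is a minimum and the supremum in [harmonic_diameter] is a
   maximum. *)

Section ConvexBodies.
Context {R : realType} {n : nat}.
Implicit Types (A K C : set 'rV[R]_n) (x t : 'rV[R]_n) (l rho : R).

Definition dilate l A : set 'rV[R]_n := [set l *: x | x in A].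

Definition translate t A : set 'rV[R]_n := [set t + x | x in A].

Definition oppset A : set 'rV[R]_n := [set - x | x in A].

Definition convex_body K : Prop :=
  [/\ K !=set0, compact K & @convex_set R 'rV[R]_n K].

Definition is_point K : Prop := exists x, K = [set x].

Definition convex_hull A : set 'rV[R]_n :=
  smallest (@convex_set R 'rV[R]_n) A.

Definition gauge C x : R := inf [set l | 0 <= l /\ dilate l C x].

Definition circumradius K C : R :=
  inf [set rho | 0 <= rho /\ exists t, K `<=` translate t (dilate rho C)].

Definition inradius K C : R :=
  sup [set rho | 0 <= rho /\ exists t, translate t (dilate rho C) `<=` K].

Definition minkowski_asymmetry C : R := circumradius C (oppset C).

Definition minkowski_centered C : Prop :=
  C `<=` dilate (- minkowski_asymmetry C) C.

Definition harmonic_diameter K C : R :=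
  sup [set (gauge C (x - y) + gauge (oppset C) (x - y)) / 2
      | x in K & y in K].

Definition f_HM C K : R * R :=
  (inradius K C / circumradius K C,
   harmonic_diameter K C / (2 * circumradius K C)).

Definition convex_bodies_not_point : set (set 'rV[R]_n) :=
  [set K | convex_body K /\ ~ is_point K].

End ConvexBodies.

(* [row_free] of the two edge vectors is affine independence of the vertices. *)
Definition triangle {R : realType} (S : set 'rV[R]_2) : Prop :=
  exists a b c : 'rV[R]_2,
    row_free (col_mx (b - a) (c - a)) /\ S = convex_hull [set a; b; c].

(* Main.v *)
Require Import Defs.
From mathcomp Require Import all_boot all_order all_algebra.
From mathcomp Require Import all_classical all_reals all_analysis.
From mathcomp Require Import ring lra.

Import Order.TTheory GRing.Theory Num.Theory.
Import numFieldNormedType.Exports.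

Local Open Scope classical_set_scope.
Local Open Scope ring_scope.

Set Implicit Arguments.
Unset Strict Implicit.

(** Being Minkowski-centered forces the centroid of the triangle to be the
    origin ([triangle_vertices_sum]).  There are then three linear forms
    [u1], [u2], [u3] with sum [0] such that the triangle is
    [{x | u_i x >= -1 for all i}], and every quantity in the theorem becomes a
    statement about the values of these forms on [K].  A homothetic copy
    [t + l S] is [{x | u_i x >= u_i t - l}]; the two gauges are the maxima of the
    [- u_i] and of the [u_i], so that the harmonic diameter is half of the
    largest oscillation on [K] of one of the differences [u_i - u_j]
    ([spread_le]); and the circumradius is [- (m1 + m2 + m3) / 3], where [m_i]
    is the minimum of [u_i] on [K] ([circumradius_min]).  Write [D], [r] and
    [rho] for the harmonic diameter, the inradius and the circumradius.

    The inequalities.  Let [p_i] be a point of [K] where [u_i] is minimal.  In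
    the barycentric coordinates of the circumscribed copy of the triangle the
    [p_i] are [(0, k1, 1 - k1)], [(1 - k2, 0, k2)] and [(k3, 1 - k3, 0)].  The
    three differences of coordinates, each taken at two of these points,
    oscillate by [1 + (k1 - k2)], [1 + (k2 - k3)] and [1 + (k3 - k1)]; these
    numbers have sum [3] and are at most [w = 2 D / (3 rho)], whence [w >= 1].
    Moreover, the points [(1 - k1) p2 + k1 p3], [(1 - k2) p3 + k2 p1] and
    [(1 - k3) p1 + k3 p2] are the vertices of a homothetic copy of the
    triangle with ratio [k1 k2 k3 + (1 - k1) (1 - k2) (1 - k3)] to the
    circumscribed one ([inscribed_triangle_copy]), and this ratio is at least
    [1 / 4 - (w - 1) ^ 2] ([inscribed_ratio_ge]), which is the left-hand side
    of the last inequality.  The other inequalities are monotonicity.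

    Attainment.  For given [w] and [x], take the touching points
    [(0, k, 1 - k)], [(l, 0, 1 - l)] and [(l, 1 - l, 0)] with [k + l = w], and a
    symmetrically placed copy of the triangle of ratio [x].  The body is the
    polygon of all points of the triangle that respect the bound [w] on the
    oscillations and do not lie beyond the copy in the directions of the three
    outer normals of the triangle of touching points ([region]).  The touching
    points lie in it and attain the bounds for the circumradius and for the
    harmonic diameter.  The inradius is exactly [x], because a nontrivial
    nonnegative combination of the three normals vanishes: the copy cannot be
    enlarged between its three supporting lines ([region_copy_le]). *)

(** * Convex sets *)

Lemma convex_setP {R : realType} {n : nat} (K : set 'rV[R]_n) :
  @convex_set R 'rV[R]_n K <->
  forall x y k, 0 <= k -> k <= 1 -> K x -> K y -> K (k *: x + (1 - k) *: y).
Proof.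
split=> [cK x y k k0 k1 Kx Ky | cK x y k /set_mem Kx /set_mem Ky].
  apply: set_mem.
  by have := cK x y (Itv01 k0 k1) (mem_set Kx) (mem_set Ky).
by apply: mem_set; apply: (cK x y k%:num).
Qed.

Lemma convex_set3 {R : realType} {n : nat} (K : set 'rV[R]_n) x y z
    (k l m : R) :
  @convex_set R 'rV[R]_n K -> K x -> K y -> K z ->
  0 <= k -> 0 <= l -> 0 <= m -> k + l + m = 1 ->
  K (k *: x + l *: y + m *: z).
Proof.
move=> /convex_setP cK Kx Ky Kz k0 l0 m0 klm.
have [kl0|kl0] := eqVneq (k + l) 0.
  have -> : k = 0 by lra.
  have -> : l = 0 by lra.
  have -> : m = 1 by lra.
  by rewrite !scale0r scale1r !add0r.
have kl_gt0 : 0 < k + l by rewrite lt_neqAle eq_sym kl0 addr_ge0.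
have Kxy : K ((k / (k + l)) *: x + (1 - k / (k + l)) *: y).
  apply: cK => //; first by rewrite divr_ge0 // ltW.
  by rewrite ler_pdivrMr //; lra.
have := cK _ _ (k + l) (ltW kl_gt0) _ Kxy Kz.
rewrite scalerDr !scalerA.
have -> : (k + l) * (k / (k + l)) = k by field.
have -> : (k + l) * (1 - k / (k + l)) = l by field.
have -> : 1 - (k + l) = m by lra.
by apply; lra.
Qed.

Lemma convex_hull_sub {R : realType} {n : nat} (A K : set 'rV[R]_n) :
  @convex_set R 'rV[R]_n K -> A `<=` K -> convex_hull A `<=` K.
Proof. by move=> cK AK x; apply. Qed.

Lemma mem_convex_hull3 {R : realType} {n : nat} (a b c x : 'rV[R]_n) :
  convex_hull [set a; b; c] x <->
  exists k l, [/\ 0 <= k, 0 <= l, k + l <= 1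
    & x = a + k *: (b - a) + l *: (c - a)].
Proof.
split=> [|[k [l [k0 l0 kl1 ->]]] M [/= cM vM]].
  pose T : set 'rV[R]_n := [set y | exists k l : R,
    [/\ 0 <= k, 0 <= l, k + l <= 1 & y = a + k *: (b - a) + l *: (c - a)]].
  apply: (@convex_hull_sub _ _ _ T).
    apply/convex_setP => y z m m0 m1 [k [l [k0 l0 kl1 ->]]].
    move=> [k' [l' [k'0 l'0 kl'1 ->]]].
    exists (m * k + (1 - m) * k'), (m * l + (1 - m) * l').
    split; [nra | nra | nra |].
    by apply/rowP => i; rewrite !mxE; ring.
  move=> _ [[->|->]|->].
  - by exists 0, 0; split; [lra.. |]; rewrite !scale0r !addr0.
  - by exists 1, 0; split; [lra.. |]; rewrite scale0r scale1r addr0 subrKC.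
  - by exists 0, 1; split; [lra.. |]; rewrite scale0r scale1r addr0 subrKC.
have -> : a + k *: (b - a) + l *: (c - a)
    = (1 - k - l) *: a + k *: b + l *: c.
  by apply/rowP => i; rewrite !mxE; ring.
apply: convex_set3 => //; try lra.
- by apply: vM; left; left.
- by apply: vM; left; right.
- by apply: vM; right.
Qed.

(** * The cross product in the plane *)

Section Cross.
Context {R : realType}.
Implicit Types x y : 'rV[R]_2.

Definition cross x y : R := x 0 0 * y 0 1 - x 0 1 * y 0 0.

Lemma rV2P x y : x 0 0 = y 0 0 -> x 0 1 = y 0 1 -> x = y.
Proof.
move=> xy0 xy1; apply/rowP => -[[|[|//]] ltj2].
- by rewrite [Ordinal _](_ : _ = 0) //; apply: val_inj.
- by rewrite [Ordinal _](_ : _ = 1) //; apply: val_inj.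
Qed.

Lemma cross_continuous y : continuous (cross ^~ y).
Proof.
move=> x.
have coordM i k : {for x, continuous (fun z : 'rV[R]_2 => z 0 i * k : R^o)}.
  by apply: continuousM; [exact: coord_continuous | exact: cst_continuous].
exact: continuousB (coordM 0 _) (coordM 1 _).
Qed.

Lemma row_free_independent x y (k l : R) :
  row_free (col_mx x y) -> k *: x + l *: y = 0 -> k = 0 /\ l = 0.
Proof.
move=> xy_free kl0.
have : row_mx k%:M l%:M *m col_mx x y = (0 : 'M[R]_(1, 1 + 1)) *m col_mx x y.
  by rewrite mul_row_col !mul_scalar_mx kl0 mul0mx.
move/(row_free_inj xy_free); rewrite -row_mx0 => /eq_row_mx [k0 l0].
split.
  by have := congr1 (fun M : 'M[R]_1 => M 0 0) k0; rewrite !mxE eqxx.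
by have := congr1 (fun M : 'M[R]_1 => M 0 0) l0; rewrite !mxE eqxx.
Qed.

Lemma row_free_cross x y : row_free (col_mx x y) -> cross x y != 0.
Proof.
move=> xy_free; apply/eqP => xy0; rewrite /cross in xy0.
have indep k l := @row_free_independent x y k l xy_free.
(* If the cross product vanishes, the coordinates themselves are the
   coefficients of linear relations, so that both vectors are zero. *)
have [y1 x1] : y 0 1 = 0 /\ - x 0 1 = 0.
  by apply: indep; apply: rV2P; rewrite !mxE; lra.
have [y0 x0] : y 0 0 = 0 /\ - x 0 0 = 0.
  by apply: indep; apply: rV2P; rewrite !mxE; lra.
have [] : (1 : R) = 0 /\ (0 : R) = 0; last by move/eqP; rewrite oner_eq0.
by apply: indep; apply: rV2P; rewrite !mxE; lra.
Qed.

End Cross.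

(** * Minkowski-centered triangles *)

(** With [t = a + b + c], the set [t - 2 S] is the triangle whose edges have
    midpoints [a], [b], [c]. *)
Lemma minkowski_asymmetry_triangle_le2 (R : realType) (a b c : 'rV[R]_2)
    (S := convex_hull [set a; b; c]) : 0 <= minkowski_asymmetry S <= 2.
Proof.
have S2 : exists t, S `<=` translate t (dilate 2 (oppset S)).
  exists (a + b + c) => x /mem_convex_hull3 [k [l [k0 l0 kl1 xE]]].
  exists (x - (a + b + c)); last by rewrite subrKC.
  exists (2^-1 *: (x - (a + b + c))).
    exists (- (2^-1 *: (x - (a + b + c)))); last by rewrite opprK.
    apply/mem_convex_hull3; exists ((1 - k) / 2), ((1 - l) / 2).
    split; [lra.. |].
    by rewrite xE; apply/rowP => i; rewrite !mxE; field.
  by rewrite scalerA mulfV ?scale1r // pnatr_eq0.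
apply/andP; split.
  by apply: lb_le_inf => [|l [//]]; exists 2; split.
by apply: ge_inf; [exists 0 => l [] | split].
Qed.

(** Writing each vertex as an element of [- s S], with [s] the asymmetry, and
    comparing the three equations gives [s >= 2].  As also [s <= 2], every
    estimate is an equality, and the equation for [a] becomes
    [3 a + (b - a) + (c - a) = 0]. *)
Lemma triangle_vertices_sum (R : realType) (a b c : 'rV[R]_2) :
  row_free (col_mx (b - a) (c - a)) ->
  minkowski_centered (convex_hull [set a; b; c]) -> a + b + c = 0.
Proof.
move=> abc_free; rewrite /minkowski_centered.
set S := convex_hull _; set s := minkowski_asymmetry S => centered.
have /andP[s0 s2] : 0 <= s <= 2 := minkowski_asymmetry_triangle_le2 a b c.
have vertex k l : 0 <= k -> 0 <= l -> k + l <= 1 ->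
    exists k' l', [/\ 0 <= k', 0 <= l', k' + l' <= 1 &
      (1 + s) *: a + (k + s * k') *: (b - a) + (l + s * l') *: (c - a) = 0].
  move=> k0 l0 kl1.
  have /centered : S (a + k *: (b - a) + l *: (c - a)).
    by apply/mem_convex_hull3; exists k, l.
  move=> [y /mem_convex_hull3 [k' [l' [k'0 l'0 kl'1 ->]]] yE].
  exists k', l'; split=> //; apply/rowP => i.
  by move/rowP: yE => /(_ i); rewrite !mxE; lra.
have [||| ka [la [ka0 la0 kla1 Ea]]] := vertex 0 0; [lra.. |].
have [||| kb [lb [kb0 lb0 klb1 Eb]]] := vertex 1 0; [lra.. |].
have [||| kc [lc [kc0 lc0 klc1 Ec]]] := vertex 0 1; [lra.. |].
have [] := @row_free_independent _ _ _ (s * ka - (1 + s * kb))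
  (s * la - s * lb) abc_free.
  apply/rowP => i; move/rowP: Ea => /(_ i); move/rowP: Eb => /(_ i).
  by rewrite !mxE; lra.
move=> kab _.
have [] := @row_free_independent _ _ _ (s * ka - s * kc)
  (s * la - (1 + s * lc)) abc_free.
  apply/rowP => i; move/rowP: Ea => /(_ i); move/rowP: Ec => /(_ i).
  by rewrite !mxE; lra.
move=> _ lac.
have skb : 0 <= s * kb by apply: mulr_ge0.
have slc : 0 <= s * lc by apply: mulr_ge0.
have skl : s * (ka + la) <= s * 1 by apply: ler_wpM2l.
have ska1 : s * ka = 1 by lra.
have sla1 : s * la = 1 by lra.
have s_2 : s = 2 by lra.
by apply/rowP => i; move/rowP: Ea => /(_ i); rewrite !mxE ska1 sla1 s_2; lra.
Qed.

(** * The ratio of an inscribed copy *)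

Section InscribedRatio.
Context {R : realFieldType}.
Implicit Types k w : R.

(** With [k_i = 1 / 2 + x_i] the claim reads
    [(x1 - x2) ^ 2 + x1 x2 + x2 x3 + x3 x1 >= 0].  The left-hand side is affine
    in [x3], and the hypotheses confine [x3] to the interval from
    [2 x2 - x1] to [2 x1 - x2], at whose ends it equals [3 x2 ^ 2] and
    [3 x1 ^ 2]. *)
Lemma inscribed_ratio_ge_max k1 k2 k3 :
  k2 - k3 <= k1 - k2 -> k3 - k1 <= k1 - k2 ->
  1 / 4 - (k1 - k2) ^+ 2
    <= k1 * k2 * k3 + (1 - k1) * (1 - k2) * (1 - k3).
Proof.
move=> h1 h2.
have [s0|s0] := leP 0 (k1 + k2 - 1).
  have := mulr_ge0 s0 (_ : 0 <= k3 - (2 * k2 - k1)).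
  by have := sqr_ge0 (k2 - 1 / 2); nra.
have := mulr_ge0 (_ : 0 <= 1 - k1 - k2) (_ : 0 <= 2 * k1 - k2 - k3).
by have := sqr_ge0 (k1 - 1 / 2); nra.
Qed.

Lemma inscribed_ratio_ge k1 k2 k3 w :
  k1 - k2 <= w -> k2 - k3 <= w -> k3 - k1 <= w ->
  1 / 4 - w ^+ 2 <= k1 * k2 * k3 + (1 - k1) * (1 - k2) * (1 - k3).
Proof.
move=> w1 w2 w3.
have mono d : 0 <= d -> d <= w -> 1 / 4 - w ^+ 2 <= 1 / 4 - d ^+ 2 by nra.
have [h12|h12] := leP (k2 - k3) (k1 - k2).
  have [h31|h31] := leP (k3 - k1) (k1 - k2).
    by have := @inscribed_ratio_ge_max k1 k2 k3; have := mono (k1 - k2); lra.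
  by have := @inscribed_ratio_ge_max k3 k1 k2; have := mono (k3 - k1); lra.
have [h32|h32] := leP (k3 - k1) (k2 - k3).
  by have := @inscribed_ratio_ge_max k2 k3 k1; have := mono (k2 - k3); lra.
by have := @inscribed_ratio_ge_max k3 k1 k2; have := mono (k3 - k1); lra.
Qed.

End InscribedRatio.

(** * The extremal polygons in barycentric coordinates *)

Section Region.
Context {R : realFieldType}.
Implicit Types k l x t tau v w : R.

(** The outer normals of the triangle with vertices [(0, k, 1 - k)],
    [(l, 0, 1 - l)], [(l, 1 - l, 0)]: [edge1] vanishes on the line through the
    last two of them, [edge2] on the line through the first and the last,
    [edge3] on the line through the first two. *)
Definition edge1 l v1 v2 v3 := (1 - l) * v1 - l * v2 - l * v3.
Definition edge2 k l v1 v2 v3 :=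
  - ((1 - l) * (1 - k)) * v1 + l * (1 - k) * v2 - l * k * v3.
Definition edge3 k l v1 v2 v3 :=
  - ((1 - l) * k) * v1 - l * (1 - k) * v2 + l * k * v3.

(** The copy of ratio [x] has the vertices [(t + x, tau, tau)],
    [(t, tau + x, tau)] and [(t, tau, tau + x)].  It must stay within the
    bounds that the touching points set for the differences of coordinates,
    and each of its vertices must lie on or beyond one edge of the triangle of
    touching points.  The bound on [2 k - 1] concerns the difference of the
    last two coordinates at the first touching point. *)
Definition admissible k l x t tau : Prop :=
  [/\ 1 / 2 <= k <= 1, 1 / 2 <= l <= 1 & 2 * (2 * k - 1) <= k + l] /\
  [/\ 0 <= x, 0 <= t, 0 <= tau & t + 2 * tau + x = 1] /\
  [/\ 2 * x <= k + l, tau - t + x <= k & t - tau + x <= l] /\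
  [/\ 0 <= edge1 l (t + x) tau tau, 0 <= edge2 k l t (tau + x) tau
    & 0 <= edge3 k l t tau (tau + x)].

(** The last three inequalities say that the region does not reach beyond the copy in the
    directions of the three normals. *)
Definition region k l x t tau v1 v2 v3 : Prop :=
  [/\ 0 <= v1, 0 <= v2 & 0 <= v3] /\
  [/\ v2 - v1 <= k, v1 - v2 <= l, v3 - v1 <= k & v1 - v3 <= l] /\
  [/\ v2 - v3 <= (k + l) / 2 & v3 - v2 <= (k + l) / 2] /\
  [/\ edge1 l v1 v2 v3 <= edge1 l (t + x) tau tau,
      edge2 k l v1 v2 v3 <= edge2 k l t (tau + x) tau
    & edge3 k l v1 v2 v3 <= edge3 k l t tau (tau + x)].

Lemma region_touching k l x t tau : admissible k l x t tau ->
  [/\ region k l x t tau 0 k (1 - k), region k l x t tau l 0 (1 - l)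
    & region k l x t tau l (1 - l) 0].
Proof.
move=> [[/andP[k0 k1] /andP[l0 l1] kl] [_ [_ [e1 e2 e3]]]].
have le_edges v1 v2 v3 : edge1 l v1 v2 v3 <= 0 -> edge2 k l v1 v2 v3 <= 0 ->
    edge3 k l v1 v2 v3 <= 0 ->
    [/\ edge1 l v1 v2 v3 <= edge1 l (t + x) tau tau,
      edge2 k l v1 v2 v3 <= edge2 k l t (tau + x) tau
    & edge3 k l v1 v2 v3 <= edge3 k l t tau (tau + x)].
  by move=> h1 h2 h3; split;
    [exact: le_trans e1 | exact: le_trans e2 | exact: le_trans e3].
have ll : 0 <= l * (1 - l) by apply: mulr_ge0; lra.
split.
all: split; first by split; lra.
all: split; first by split; lra.
all: split; first by split; lra.
all: clear e1 e2 e3; apply: le_edges; rewrite /edge1 /edge2 /edge3; lra.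
Qed.

Lemma region_copy k l x t tau v1 v2 v3 : admissible k l x t tau ->
  v1 + v2 + v3 = 1 -> t <= v1 -> tau <= v2 -> tau <= v3 ->
  region k l x t tau v1 v2 v3.
Proof.
move=> [[/andP[k0 k1] /andP[l0 l1] kl] [[x0 t0 tau0 sumt] [[xkl tk tl] _]]].
move=> sumv ge1 ge2 ge3.
split; first by split; lra.
split; first by split; lra.
split; first by split; lra.
have -> : x = (v1 - t) + (v2 - tau) + (v3 - tau) by lra.
have [s1 s2 s3] : [/\ 0 <= v1 - t, 0 <= v2 - tau & 0 <= v3 - tau].
  by split; lra.
have kM s : 0 <= s -> 0 <= k * s by move=> ?; apply: mulr_ge0; lra.
have lM s : 0 <= s -> 0 <= l * s by move=> ?; apply: mulr_ge0; lra.
have k'M s : 0 <= s -> 0 <= (1 - k) * s by move=> ?; apply: mulr_ge0; lra.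
split; rewrite /edge1 /edge2 /edge3.
- by lra.
- by have := k'M _ s1; have := lM _ s3; lra.
- by have := kM _ s1; have := lM _ s2; lra.
Qed.

(** On points with coordinate sum [m], [(1 - l) edge1 + edge2 + edge3] is
    [- l (1 - l) m].  Evaluating the three forms at the respective vertices of
    a copy of ratio [r] and adding with these weights gives [r - l (1 - l)], so
    the three edge constraints together bound [r] by the value [x] for which
    they are equalities. *)
Lemma region_copy_le k l x t tau r w1 w2 w3 : admissible k l x t tau ->
  w1 + w2 + w3 + r = 1 ->
  region k l x t tau (w1 + r) w2 w3 -> region k l x t tau w1 (w2 + r) w3 ->
  region k l x t tau w1 w2 (w3 + r) -> r <= x.
Proof.
move=> [[_ /andP[_ l1] _] [[_ _ _ sumt] _]] sumw.
move=> [_ [_ [_ [e1 _ _]]]] [_ [_ [_ [_ e2 _]]]] [_ [_ [_ [_ _ e3]]]].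
have l'_ge0 : 0 <= 1 - l by lra.
have := ler_wpM2l l'_ge0 e1; move: e2 e3; rewrite /edge1 /edge2 /edge3.
have -> : w1 = 1 - r - w2 - w3 by lra.
have -> : t = 1 - x - 2 * tau by lra.
by lra.
Qed.

(** For [w = 1] the touching points are the midpoints of the edges.  Up to
    [w = 3 / 2] two of them move towards the vertex [(1, 0, 0)]; beyond that
    value both coincide with this vertex, which the copy then contains, and the
    third moves along the opposite edge. *)
Lemma admissible_exists w x : 1 <= w <= 2 -> 0 <= x -> 2 * x <= w ->
  1 / 4 - (w - 1) ^+ 2 <= x ->
  exists k l t tau, k + l = w /\ admissible k l x t tau.
Proof.
move=> /andP[w1 w2] x0 xw wx; have [w_small|w_big] := leP w (3 / 2).
  (* The smallest [t] allowed: below [l - x] the vertex [(t + x, tau, tau)]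
     would lie inside the triangle of touching points, and below [x / 3] the
     copy would violate [v2 - v1 <= k]. *)
  pose l := w - 1 / 2; pose t := Num.max (l - x) (x / 3).
  exists (1 / 2), l, t, ((1 - x - t) / 2); split; first by rewrite /l; lra.
  have lE : l = w - 1 / 2 by [].
  have [t1 t2] : l - x <= t /\ x / 3 <= t by rewrite !le_max !lexx orbT.
  have [t3 t4] : t <= (1 + 2 * l) / 3 - x /\ t <= 1 - x.
    by rewrite !ge_max; split; apply/andP; split; lra.
  have lx : l * (1 - l) <= x by rewrite lE; lra.
  have lt : (1 - l) * t <= l * x.
    have lxM := mulr_ge0 (_ : 0 <= l - 1 / 2) x0.
    by rewrite /t /Num.max; case: ltP => _; lra.
  clearbody l t.
  split; first by split; [apply/andP; split | apply/andP; split |]; lra.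
  split; first by split; lra.
  split; first by split; lra.
  by rewrite /edge1 /edge2 /edge3; split; lra.
exists (w - 1), 1, (1 - x), 0; split; first by lra.
split; first by split; [apply/andP; split | apply/andP; split |]; lra.
split; first by split; lra.
split; first by split; lra.
have [? ?] : 0 <= (2 - w) * x /\ 0 <= (w - 1) * x.
  by split; apply: mulr_ge0; lra.
by rewrite /edge1 /edge2 /edge3; split; lra.
Qed.

End Region.

(** * The linear forms of a centered triangle *)

Lemma inf_ray (R : realType) (m : R) (A : set R) :
  A = [set l | m <= l] -> inf A = m.
Proof.
move=> ->; apply/eqP; rewrite eq_le; apply/andP; split.
  by apply: ge_inf; [exists m | rewrite /=].
by apply: lb_le_inf; [exists m => /= | move=> l].
Qed.

Section CenteredTriangle.
Context {R : realType} (a b c : 'rV[R]_2).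
Context (abc0 : a + b + c = 0) (ab_indep : cross a b != 0).
Implicit Types (x y z t : 'rV[R]_2) (K : set 'rV[R]_2) (k l d : R).

(** For an edge [p q] of the triangle with vertices [a], [b], [c] in this
    cyclic order, the form that is constant on the edge, scaled to the
    value [-1] there; it then takes the value [2] at the opposite vertex. *)
Definition level p q x : R := cross x (p - q) / cross a b.

Local Notation u1 := (level b c).
Local Notation u2 := (level c a).
Local Notation u3 := (level a b).
Local Notation S := (convex_hull [set a; b; c]).

Lemma levelD p q x y : level p q (x + y) = level p q x + level p q y.
Proof. by rewrite /level /cross !mxE; ring. Qed.

Lemma levelZ p q k x : level p q (k *: x) = k * level p q x.
Proof. by rewrite /level /cross !mxE; ring. Qed.

Lemma levelN p q x : level p q (- x) = - level p q x.
Proof. by rewrite -scaleN1r levelZ mulN1r. Qed.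

Definition levelE := (levelD, levelN, levelZ).

Lemma level_continuous p q : continuous (level p q).
Proof.
move=> x.
have : {for x, continuous (fun z => cross z (p - q) * (cross a b)^-1 : R^o)}.
  by apply: continuousM; [exact: cross_continuous | exact: cst_continuous].
by [].
Qed.

Lemma level_sum x : u1 x + u2 x + u3 x = 0.
Proof. by rewrite /level /cross !mxE; ring. Qed.

Lemma third_vertex : c = - (a + b).
Proof. by apply/eqP; rewrite -addr_eq0 addrC abc0. Qed.

Lemma level_vertices :
  [/\ [/\ u1 a = 2, u1 b = -1 & u1 c = -1],
      [/\ u2 a = -1, u2 b = 2 & u2 c = -1] &
      [/\ u3 a = -1, u3 b = -1 & u3 c = 2]].
Proof.
rewrite third_vertex; move: ab_indep; rewrite /level /cross !mxE => ab0.
by do !split; field.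
Qed.

Lemma level_decomp x :
  x = (u1 x / 3) *: a + (u2 x / 3) *: b + (u3 x / 3) *: c.
Proof.
move: ab_indep; rewrite third_vertex /level /cross => ab0.
by apply: rV2P; rewrite !mxE; field.
Qed.

Lemma level_eq x y : u1 x = u1 y -> u2 x = u2 y -> x = y.
Proof.
move=> e1 e2; have e3 : u3 x = u3 y.
  by have := level_sum x; have := level_sum y; lra.
by rewrite [x]level_decomp [y]level_decomp e1 e2 e3.
Qed.

Lemma level_onto (x1 x2 x3 : R) : x1 + x2 + x3 = 0 ->
  exists x, [/\ u1 x = x1, u2 x = x2 & u3 x = x3].
Proof.
move=> sum0; exists ((x1 / 3) *: a + (x2 / 3) *: b + (x3 / 3) *: c).
have [[? ? ?] [? ? ?] [? ? ?]] := level_vertices.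
by split; rewrite !levelE; nra.
Qed.

Lemma mem_triangle x : S x <-> [/\ -1 <= u1 x, -1 <= u2 x & -1 <= u3 x].
Proof.
have [[? ? ?] [? ? ?] [? ? ?]] := level_vertices.
split=> [|[x1 x2 x3]].
  move: x; apply: convex_hull_sub; last by move=> _ [[->|->]|->]; split; lra.
  apply/convex_setP => y z k k0 k1 [y1 y2 y3] [z1 z2 z3].
  by split; rewrite !levelE; nra.
have sumx := level_sum x.
apply/mem_convex_hull3; exists ((u2 x + 1) / 3), ((u3 x + 1) / 3).
split; [lra.. |].
by apply: level_eq; rewrite !levelE; nra.
Qed.

Lemma mem_dilate l x : 0 <= l ->
  dilate l S x <-> [/\ - l <= u1 x, - l <= u2 x & - l <= u3 x].
Proof.
move=> l0; split=> [[y /mem_triangle [y1 y2 y3] <-]|[x1 x2 x3]].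
  by split; rewrite !levelE; nra.
have [l00|ln0] := eqVneq l 0.
  have sumx := level_sum x; exists 0.
    by apply/mem_triangle; rewrite /level /cross !mxE; split; lra.
  rewrite scaler0; apply: level_eq;
    by rewrite -[0](scale0r 0) levelZ mul0r; lra.
exists (l^-1 *: x); last by rewrite scalerA mulfV // scale1r.
have lgt : 0 < l by rewrite lt_neqAle eq_sym ln0.
by apply/mem_triangle; split; rewrite levelZ mulrC ler_pdivlMr // mulN1r.
Qed.

Lemma mem_translate_dilate t l x : 0 <= l ->
  translate t (dilate l S) x <->
  [/\ u1 t - l <= u1 x, u2 t - l <= u2 x & u3 t - l <= u3 x].
Proof.
move=> l0; split=> [[y /(mem_dilate _ l0) [y1 y2 y3] <-]|[x1 x2 x3]].
  by rewrite !levelE; split; lra.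
exists (x - t); last by rewrite addrC subrK.
by apply/(mem_dilate _ l0); rewrite !levelE; split; lra.
Qed.

Lemma mem_dilate_opp l x : 0 <= l ->
  dilate l (oppset S) x <-> [/\ u1 x <= l, u2 x <= l & u3 x <= l].
Proof.
move=> l0; have -> : dilate l (oppset S) x <-> dilate l S (- x).
  split=> [[_ [y Sy <-] <-]|[y Sy yx]].
    by exists y => //; rewrite scalerN opprK.
  by exists (- y); [exists y | rewrite scalerN yx opprK].
by rewrite mem_dilate // !levelN; split=> -[? ? ?]; split; lra.
Qed.

Lemma gauge_le x l :
  gauge S x <= l <-> [/\ - l <= u1 x, - l <= u2 x & - l <= u3 x].
Proof.
have sumx := level_sum x.
have -> : gauge S x = Num.max (- u1 x) (Num.max (- u2 x) (- u3 x)).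
  apply: inf_ray; apply/seteqP; split=> k /=.
    by move=> [k0 /(mem_dilate _ k0) [x1 x2 x3]]; rewrite !ge_max; lra.
  rewrite !ge_max => /andP[x1 /andP[x2 x3]].
  have k0 : 0 <= k by lra.
  by split=> //; apply/mem_dilate => //; split; lra.
rewrite !ge_max; split=> [/andP[? /andP[? ?]]|[? ? ?]]; first by split; lra.
by apply/and3P; split; lra.
Qed.

Lemma gauge_opp_le x l :
  gauge (oppset S) x <= l <-> [/\ u1 x <= l, u2 x <= l & u3 x <= l].
Proof.
have sumx := level_sum x.
have -> : gauge (oppset S) x = Num.max (u1 x) (Num.max (u2 x) (u3 x)).
  apply: inf_ray; apply/seteqP; split=> k /=.
    by move=> [k0 /(mem_dilate_opp _ k0) [x1 x2 x3]]; rewrite !ge_max; lra.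
  rewrite !ge_max => /andP[x1 /andP[x2 x3]].
  have k0 : 0 <= k by lra.
  by split=> //; apply/mem_dilate_opp => //; split; lra.
by rewrite !ge_max; split=> [/and3P|[? ? ?]] //; apply/and3P.
Qed.

(** The sum of the two gauges is [max u_i - min u_j]. *)
Lemma spread_le x d : (gauge S x + gauge (oppset S) x) / 2 <= d <->
  [/\ `|u1 x - u2 x| <= 2 * d, `|u2 x - u3 x| <= 2 * d
    & `|u3 x - u1 x| <= 2 * d].
Proof.
rewrite !ler_norml; split=> [le_d|].
  have /gauge_le [? ? ?] := lexx (gauge S x).
  have /gauge_opp_le [? ? ?] := lexx (gauge (oppset S) x).
  by split; lra.
move=> [/andP[? ?] /andP[? ?] /andP[? ?]].
suff : gauge (oppset S) x <= 2 * d - gauge S x by lra.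
have le_sub l : l <= 2 * d - gauge S x <-> gauge S x <= 2 * d - l.
  by split; lra.
by apply/gauge_opp_le; split; apply/le_sub/gauge_le; split; lra.
Qed.

(** * Radii and harmonic diameter in terms of the linear forms *)

Definition level_bounded K := exists B : R, forall x, K x ->
  [/\ `|u1 x| <= B, `|u2 x| <= B & `|u3 x| <= B].

Lemma compact_level_bounded K : compact K -> level_bounded K.
Proof.
move=> cK.
have bnd p q : exists B : R, forall x, K x -> `|level p q x| <= B.
  have cimg : compact (level p q @` K).
    apply: continuous_compact => //; apply: continuous_subspaceT.
    exact: level_continuous.
  have [B [_ HB]] := @compact_bounded _ R^o _ cimg.
  exists (B + 1) => x Kx; apply: (HB (B + 1)); first by rewrite ltrDl.
  by exists x.
have [B1 H1] := bnd b c; have [B2 H2] := bnd c a; have [B3 H3] := bnd a b.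
exists (Num.max B1 (Num.max B2 B3)) => x Kx; rewrite !le_max.
by rewrite H1 // H2 // H3 // !orbT.
Qed.

Lemma level_bounded_compact K : closed K -> level_bounded K -> compact K.
Proof.
move=> clK [B HB]; apply: bounded_closed_compact => //.
exists (B * (`|a| + `|b| + `|c|)); split; first exact: num_real.
move=> M /ltW BM x /HB [x1 x2 x3]; apply: le_trans BM.
rewrite [x in `|x|]level_decomp.
have le_term k (v : 'rV[R]_2) : `|k| <= B -> `|(k / 3) *: v| <= B * `|v|.
  move=> kB; rewrite normrZ normrM normfV [`|3|]ger0_norm //.
  by apply: ler_wpM2r => //; have := normr_ge0 k; lra.
rewrite !mulrDr; apply: le_trans (ler_normD _ _) _.
apply: lerD (le_term _ _ x3); apply: le_trans (ler_normD _ _) _.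
exact: lerD (le_term _ _ x1) (le_term _ _ x2).
Qed.

Lemma subset_triangle_bounded K : K `<=` S -> level_bounded K.
Proof.
move=> KS; exists 2 => x /KS /mem_triangle [? ? ?].
by have := level_sum x; rewrite !ler_norml; split; apply/andP; split; lra.
Qed.

Lemma level_min K p q : K !=set0 -> compact K ->
  exists2 x, K x & forall y, K y -> level p q x <= level p q y.
Proof.
move=> K0 cK.
have [|x /set_mem Kx minx] := EVT_min_rV (f := level p q) K0 cK.
  exact/continuous_subspaceT/level_continuous.
by exists x => // y Ky; apply: minx; apply: mem_set.
Qed.

Lemma harmonic_diameter_le K d : K !=set0 ->
  (forall x y, K x -> K y -> [/\ u1 x - u2 x - (u1 y - u2 y) <= 2 * d,
    u2 x - u3 x - (u2 y - u3 y) <= 2 * d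
    & u3 x - u1 x - (u3 y - u1 y) <= 2 * d]) ->
  harmonic_diameter K S <= d.
Proof.
move=> [x0 Kx0] le_d; apply: ge_sup.
  exists ((gauge S (x0 - x0) + gauge (oppset S) (x0 - x0)) / 2), x0 => //.
  by exists x0.
move=> _ [x Kx [y Ky <-]]; apply/spread_le.
have [? ? ?] := le_d x y Kx Ky; have [? ? ?] := le_d y x Ky Kx.
by rewrite !ler_norml !levelE; split; apply/andP; split; lra.
Qed.

Lemma le_harmonic_diameter K x y : level_bounded K -> K x -> K y ->
  [/\ u1 x - u2 x - (u1 y - u2 y) <= 2 * harmonic_diameter K S,
    u2 x - u3 x - (u2 y - u3 y) <= 2 * harmonic_diameter K S
    & u3 x - u1 x - (u3 y - u1 y) <= 2 * harmonic_diameter K S].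
Proof.
move=> [B HB] Kx Ky.
have : (gauge S (x - y) + gauge (oppset S) (x - y)) / 2
    <= harmonic_diameter K S.
  apply: ub_le_sup; last by exists x => //; exists y.
  exists (2 * B) => _ [x' Kx' [y' Ky' <-]]; apply/spread_le.
  have := HB _ Kx'; have := HB _ Ky'; rewrite !ler_norml !levelE.
  move=> [/andP[? ?] /andP[? ?] /andP[? ?]].
  move=> [/andP[? ?] /andP[? ?] /andP[? ?]].
  by split; apply/andP; split; lra.
move/spread_le; rewrite !ler_norml !levelE.
by move=> [/andP[? ?] /andP[? ?] /andP[? ?]]; split; lra.
Qed.

(** [K] lies in [t + l S] iff [u_i t <= u_i p_i + l] for all [i]; as the
    [u_i t] are arbitrary numbers with sum [0], such a [t] exists iff the
    right-hand sides have a nonnegative sum. *)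
Lemma circumradius_min K p1 p2 p3 : K p1 -> K p2 -> K p3 ->
  (forall x, K x -> [/\ u1 p1 <= u1 x, u2 p2 <= u2 x & u3 p3 <= u3 x]) ->
  circumradius K S = - (u1 p1 + u2 p2 + u3 p3) / 3.
Proof.
move=> Kp1 Kp2 Kp3 minK; apply: inf_ray; apply/seteqP; split=> l /=.
  move=> [l0 [t KS]].
  have /mem_translate_dilate [//|? _ _] := KS _ Kp1.
  have /mem_translate_dilate [//|_ ? _] := KS _ Kp2.
  have /mem_translate_dilate [//|_ _ ?] := KS _ Kp3.
  by have := level_sum t; lra.
move=> le_l; have [? ? ?] := minK _ Kp1; have sump1 := level_sum p1.
have l0 : 0 <= l by lra.
split=> //.
pose mean := (u1 p1 + u2 p2 + u3 p3) / 3.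
have meanE : 3 * mean = u1 p1 + u2 p2 + u3 p3 by rewrite /mean; lra.
have [|t [t1 t2 t3]] :=
  @level_onto (u1 p1 - mean) (u2 p2 - mean) (u3 p3 - mean); first by lra.
exists t => x /minK [? ? ?]; apply/mem_translate_dilate => //.
by rewrite t1 t2 t3; split; lra.
Qed.

Lemma zero_copy K x : K x -> translate x (dilate 0 S) `<=` K.
Proof.
move=> Kx y /mem_translate_dilate [//|? ? ?].
have sumx := level_sum x; have sumy := level_sum y.
suff -> : y = x by [].
by apply: level_eq; lra.
Qed.

Lemma inradius_le K d : K !=set0 ->
  (forall l t, 0 <= l -> translate t (dilate l S) `<=` K -> l <= d) ->
  inradius K S <= d.
Proof.
move=> [x Kx] le_d; apply: ge_sup; last by move=> l [l0 [t]]; apply: le_d.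
by exists 0; split=> //; exists x; apply: zero_copy.
Qed.

Lemma copy_le_harmonic_diameter K t l : level_bounded K -> 0 <= l ->
  translate t (dilate l S) `<=` K -> 3 * l <= harmonic_diameter K S.
Proof.
move=> bK l0 tK; have sumt := level_sum t.
have [|x [x1 x2 x3]] := @level_onto (u1 t + 2 * l) (u2 t - l) (u3 t - l).
  by lra.
have [|y [y1 y2 y3]] := @level_onto (u1 t - l) (u2 t + 2 * l) (u3 t - l).
  by lra.
have Kx : K x by apply: tK; apply/mem_translate_dilate => //; split; lra.
have Ky : K y by apply: tK; apply/mem_translate_dilate => //; split; lra.
by have [? ? ?] := le_harmonic_diameter bK Kx Ky; lra.
Qed.

Lemma le_inradius K t l : level_bounded K -> 0 <= l ->
  translate t (dilate l S) `<=` K -> l <= inradius K S.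
Proof.
move=> bK l0 tK; apply: ub_le_sup; last by split=> //; exists t.
exists (harmonic_diameter K S / 3) => k [k0 [s sK]].
by have := copy_le_harmonic_diameter bK k0 sK; lra.
Qed.

Lemma inradius_ge0 K : level_bounded K -> K !=set0 -> 0 <= inradius K S.
Proof.
by move=> bK [x Kx]; apply: (@le_inradius _ x) => //; apply: zero_copy.
Qed.

(** * The inequalities *)

(** The point [q_i] of the proof lies on the edge of the triangle [p1 p2 p3]
    opposite to [p_i], and the segment from [q_i] to [q_j] is parallel to the
    corresponding edge of [S]; [t] is the centroid of the [q_i]. *)
Lemma inscribed_triangle_copy K p1 p2 p3 (m1 m2 m3 r k1 k2 k3 : R)
    (l := (k1 * k2 * k3 + (1 - k1) * (1 - k2) * (1 - k3)) * r) :
  @convex_set R 'rV[R]_2 K -> K p1 -> K p2 -> K p3 ->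
  0 < r -> 0 <= k1 <= 1 -> 0 <= k2 <= 1 -> 0 <= k3 <= 1 ->
  [/\ u1 p1 = m1, u2 p1 = m2 + 3 * r * k1 & u3 p1 = m3 + 3 * r * (1 - k1)] ->
  [/\ u1 p2 = m1 + 3 * r * (1 - k2), u2 p2 = m2 & u3 p2 = m3 + 3 * r * k2] ->
  [/\ u1 p3 = m1 + 3 * r * k3, u2 p3 = m2 + 3 * r * (1 - k3) & u3 p3 = m3] ->
  0 <= l /\ exists t, translate t (dilate l S) `<=` K.
Proof.
have weight_ge0 (d e m : R) : 0 < m -> e - m <= d -> 0 <= (d - e + m) / (3 * m).
  by move=> m0 ed; apply: divr_ge0; lra.
move=> cK Kp1 Kp2 Kp3 r0 /andP[k1_0 k1_1] /andP[k2_0 k2_1] /andP[k3_0 k3_1].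
move=> [p11 p12 p13] [p21 p22 p23] [p31 p32 p33].
have l0 : 0 <= l.
  apply: mulr_ge0; last exact: ltW.
  by apply: addr_ge0; rewrite !mulr_ge0 // subr_ge0.
split=> //.
have [l_0|l_n0] := eqVneq l 0.
  by exists p1; rewrite l_0; apply: zero_copy.
have sum1 := level_sum p1.
pose q1 := (1 - k1) *: p2 + k1 *: p3.
pose q2 := (1 - k2) *: p3 + k2 *: p1.
pose q3 := (1 - k3) *: p1 + k3 *: p2.
have convK k x y : 0 <= k -> k <= 1 -> K x -> K y ->
    K ((1 - k) *: x + k *: y).
  by move=> ? ? Kx Ky; rewrite addrC; move/convex_setP: cK; apply.
have Kq1 : K q1 by apply: convK.
have Kq2 : K q2 by apply: convK.
have Kq3 : K q3 by apply: convK.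
have [|t [t1 t2 t3]] := @level_onto (m1 + 3 * r * ((1 - k2) * k3) + l)
    (m2 + 3 * r * ((1 - k3) * k1) + l) (m3 + 3 * r * ((1 - k1) * k2) + l).
  by rewrite /l; move: sum1; rewrite p11 p12 p13; lra.
pose pE := (p11, p12, p13, p21, p22, p23, p31, p32, p33).
have [q11 q12 q13] : [/\ u1 q1 = u1 t + 2 * l, u2 q1 = u2 t - l
    & u3 q1 = u3 t - l].
  by split; rewrite !levelE ?t1 ?t2 ?t3 !pE /l; ring.
have [q21 q22 q23] : [/\ u1 q2 = u1 t - l, u2 q2 = u2 t + 2 * l
    & u3 q2 = u3 t - l].
  by split; rewrite !levelE ?t1 ?t2 ?t3 !pE /l; ring.
have [q31 q32 q33] : [/\ u1 q3 = u1 t - l, u2 q3 = u2 t - l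
    & u3 q3 = u3 t + 2 * l].
  by split; rewrite !levelE ?t1 ?t2 ?t3 !pE /l; ring.
clearbody q1 q2 q3 l.
exists t => x /(mem_translate_dilate _ _ l0) [x1 x2 x3].
have sumt := level_sum t; have sumx := level_sum x.
have lgt0 : 0 < l by rewrite lt_neqAle eq_sym l_n0.
have x3E : u3 x = - u1 x - u2 x by lra.
have t3E : u3 t = - u1 t - u2 t by lra.
have -> : x = ((u1 x - u1 t + l) / (3 * l)) *: q1
    + ((u2 x - u2 t + l) / (3 * l)) *: q2
    + ((u3 x - u3 t + l) / (3 * l)) *: q3.
  apply: level_eq; rewrite !levelE ?q11 ?q21 ?q31 ?q12 ?q22 ?q32 x3E t3E;
    by field.
apply: convex_set3 => //;
  [exact: weight_ge0 | exact: weight_ge0 | exact: weight_ge0 |].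
by rewrite x3E t3E; field.
Qed.

Lemma diagram_inequalities K : convex_bodies_not_point K ->
  0 < circumradius K S /\
  [/\ harmonic_diameter K S <= 3 * circumradius K S,
      3 * inradius K S <= harmonic_diameter K S,
      0 <= inradius K S,
      circumradius K S <= 2 / 3 * harmonic_diameter K S
    & 4 / 9 * (harmonic_diameter K S / circumradius K S - 3 / 4)
            * (9 / 4 - harmonic_diameter K S / circumradius K S)
      <= inradius K S / circumradius K S].
Proof.
move=> [[K0 cptK cK] not_point].
have bK := compact_level_bounded cptK.
have [p1 Kp1 min1] := level_min b c K0 cptK.
have [p2 Kp2 min2] := level_min c a K0 cptK.
have [p3 Kp3 min3] := level_min a b K0 cptK.
have minK x : K x -> [/\ u1 p1 <= u1 x, u2 p2 <= u2 x & u3 p3 <= u3 x].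
  by move=> Kx; split; [exact: min1 | exact: min2 | exact: min3].
have rE := circumradius_min Kp1 Kp2 Kp3 minK.
set r := circumradius K S in rE *; set D := harmonic_diameter K S.
have sum1 := level_sum p1; have sum2 := level_sum p2.
have sum3 := level_sum p3.
have [? min12 min13] := minK _ Kp1; have [min21 ? min23] := minK _ Kp2.
have [min31 min32 ?] := minK _ Kp3.
have r_gt0 : 0 < r.
  rewrite lt_neqAle; apply/andP; split; last by lra.
  apply/eqP => r0; apply: not_point; exists p1.
  apply/seteqP; split=> [x Kx|_ -> //].
  have [? ? ?] := minK _ Kx; have sumx := level_sum x.
  by apply: level_eq; lra.
have [le12 _ _] := le_harmonic_diameter bK Kp2 Kp1.
have [_ le23 _] := le_harmonic_diameter bK Kp3 Kp2.
have [_ _ le31] := le_harmonic_diameter bK Kp1 Kp3.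
rewrite -/D in le12 le23 le31.
split=> //; split.
- apply: harmonic_diameter_le => // x y /minK [? ? ?] /minK [? ? ?].
  have sumx := level_sum x; have sumy := level_sum y.
  by split; lra.
- suff : inradius K S <= D / 3 by lra.
  apply: inradius_le => // l t l0 tK.
  by have := copy_le_harmonic_diameter bK l0 tK; rewrite -/D; lra.
- exact: inradius_ge0.
- by lra.
pose k1 := (u2 p1 - u2 p2) / (3 * r).
pose k2 := (u3 p2 - u3 p3) / (3 * r).
pose k3 := (u1 p3 - u1 p1) / (3 * r).
have r_n0 : r != 0 by rewrite gt_eqF.
have rk1 : 3 * r * k1 = u2 p1 - u2 p2 by rewrite /k1; field.
have rk2 : 3 * r * k2 = u3 p2 - u3 p3 by rewrite /k2; field.
have rk3 : 3 * r * k3 = u1 p3 - u1 p1 by rewrite /k3; field.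
have in01 k d : k = d / (3 * r) -> 0 <= d <= 3 * r -> 0 <= k <= 1.
  move=> -> /andP[d0 dr]; rewrite divr_ge0 //; last by lra.
  by rewrite ler_pdivrMr ?mul1r //; lra.
have k1_01 : 0 <= k1 <= 1 by apply: in01 => //; apply/andP; split; lra.
have k2_01 : 0 <= k2 <= 1 by apply: in01 => //; apply/andP; split; lra.
have k3_01 : 0 <= k3 <= 1 by apply: in01 => //; apply/andP; split; lra.
have [] := @inscribed_triangle_copy K p1 p2 p3 (u1 p1) (u2 p2) (u3 p3)
  r k1 k2 k3 cK Kp1 Kp2 Kp3 r_gt0 k1_01 k2_01 k3_01.
- by split; lra.
- by split; lra.
- by split; lra.
move=> l0 [t tK].
rewrite ler_pdivlMr //; apply: le_trans (le_inradius bK l0 tK).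
rewrite ler_pM2r //.
have wE k d : d <= 2 * D - 3 * r -> 3 * r * k = d -> k <= 2 * D / (3 * r) - 1.
  move=> dD kd; suff : k + 1 <= 2 * D / (3 * r) by lra.
  by rewrite ler_pdivlMr; lra.
apply: le_trans (@inscribed_ratio_ge _ k1 k2 k3 (2 * D / (3 * r) - 1) _ _ _).
- by rewrite le_eqVlt; apply/orP; left; apply/eqP; field.
- by apply: (@wE _ (3 * r * (k1 - k2))) => //; lra.
- by apply: (@wE _ (3 * r * (k2 - k3))) => //; lra.
- by apply: (@wE _ (3 * r * (k3 - k1))) => //; lra.
Qed.

(** * Attainment *)

Local Notation v1 x := ((u1 x + 1) / 3).
Local Notation v2 x := ((u2 x + 1) / 3).
Local Notation v3 x := ((u3 x + 1) / 3).

Lemma bary_sum x : v1 x + v2 x + v3 x = 1.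
Proof. by have := level_sum x; lra. Qed.

Lemma bary_onto (w1 w2 w3 : R) : w1 + w2 + w3 = 1 ->
  exists x, [/\ v1 x = w1, v2 x = w2 & v3 x = w3].
Proof.
move=> sumw.
have [|x [x1 x2 x3]] := @level_onto (3 * w1 - 1) (3 * w2 - 1) (3 * w3 - 1).
  by lra.
by exists x; rewrite x1 x2 x3; split; lra.
Qed.

Lemma mem_copy_bary t l x : 0 <= l ->
  translate t (dilate l S) x <->
  [/\ v1 t - l / 3 <= v1 x, v2 t - l / 3 <= v2 x & v3 t - l / 3 <= v3 x].
Proof.
move=> l0; split=> [/(mem_translate_dilate _ _ l0)|] [? ? ?]; first by split; lra.
by apply/(mem_translate_dilate _ _ l0); split; lra.
Qed.

(** Listing the constraints as data makes closedness and convexity inductions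
    on the list. *)
Definition half_plane (h : R * R * R * R) : set 'rV[R]_2 :=
  [set x | h.1.1.1 * v1 x + h.1.1.2 * v2 x + h.1.2 * v3 x <= h.2].

Definition polygon (hs : seq (R * R * R * R)) : set 'rV[R]_2 :=
  foldr (fun h A => half_plane h `&` A) setT hs.

Lemma polygon_convex hs : @convex_set R 'rV[R]_2 (polygon hs).
Proof.
apply/convex_setP => x y k k0 k1.
elim: hs => //= h hs IH [hx /IH hsx] [hy /hsx].
split=> //; move: hx hy; rewrite /half_plane /= !levelE => hx hy.
by have := ler_wpM2l k0 hx; have := ler_wpM2l (_ : 0 <= 1 - k) hy; lra.
Qed.

Lemma polygon_closed hs : closed (polygon hs).
Proof.
elim: hs => [|h hs IH] /=; first exact: closedT.
apply: closedI => //.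
have -> : half_plane h = (fun x => h.1.1.1 * v1 x + h.1.1.2 * v2 x
    + h.1.2 * v3 x : R^o) @^-1` [set y | y <= h.2] by [].
apply: closed_comp; last exact: closed_le.
have cl p q : continuous (fun z => level p q z + 1 : R^o).
  move=> x; apply: continuousD; last exact: cst_continuous.
  exact: level_continuous.
have cv p q : continuous (fun z => (level p q z + 1) / 3 : R^o).
  move=> x.
  exact: (@continuousM R _ _ (fun=> 3^-1) x (cl p q x) (@cst_continuous _ _ _ x)).
have ct k p q : continuous (fun z => k * ((level p q z + 1) / 3) : R^o).
  move=> x.
  exact: (@continuousM R _ (fun=> k) _ x (@cst_continuous _ _ _ x) (cv p q x)).
move=> x _.
exact: (continuousD (continuousD (ct _ _ _ x) (ct _ _ _ x)) (ct _ _ _ x)).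
Qed.

Lemma region_polygon (k l x t tau : R) : exists hs,
  polygon hs = [set z | region k l x t tau (v1 z) (v2 z) (v3 z)].
Proof.
exists [:: (-1, 0, 0, 0); (0, -1, 0, 0); (0, 0, -1, 0);
  (-1, 1, 0, k); (1, -1, 0, l); (-1, 0, 1, k); (1, 0, -1, l);
  (0, 1, -1, (k + l) / 2); (0, -1, 1, (k + l) / 2);
  (1 - l, - l, - l, edge1 l (t + x) tau tau);
  (- ((1 - l) * (1 - k)), l * (1 - k), - (l * k),
    edge2 k l t (tau + x) tau);
  (- ((1 - l) * k), - (l * (1 - k)), l * k, edge3 k l t tau (tau + x))].
apply/seteqP; split=> z.
  rewrite /= /half_plane /=; do 9!case=> ?; move=> [e1 [e2 [e3 _]]].
  split; first by split; lra.
  split; first by split; lra.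
  split; first by split; lra.
  by split; [apply: le_trans e1 | apply: le_trans e2 | apply: le_trans e3];
    rewrite /edge1 /edge2 /edge3; lra.
move=> [[? ? ?] [[? ? ? ?] [[? ?] [e1 e2 e3]]]].
rewrite /= /half_plane /=.
do 9![split; first by lra].
split; first by apply: le_trans e1; rewrite /edge1; lra.
split; first by apply: le_trans e2; rewrite /edge2; lra.
by split=> //; apply: le_trans e3; rewrite /edge3; lra.
Qed.

Lemma body_with_ratios (k l x t tau : R) : admissible k l x t tau ->
  exists K, [/\ convex_bodies_not_point K, circumradius K S = 1,
    inradius K S = x & harmonic_diameter K S = 3 / 2 * (k + l)].
Proof.
move=> adm; have [rp1 rp2 rp3] := region_touching adm.
have [hs KE] := region_polygon k l x t tau.
pose K := polygon hs.
have memK z : K z <-> region k l x t tau (v1 z) (v2 z) (v3 z).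
  by rewrite /K KE.
have [|p1 [p11 p12 p13]] := @bary_onto 0 k (1 - k); first by lra.
have [|p2 [p21 p22 p23]] := @bary_onto l 0 (1 - l); first by lra.
have [|p3 [p31 p32 p33]] := @bary_onto l (1 - l) 0; first by lra.
have Kp1 : K p1 by apply/memK; rewrite p11 p12 p13.
have Kp2 : K p2 by apply/memK; rewrite p21 p22 p23.
have Kp3 : K p3 by apply/memK; rewrite p31 p32 p33.
have [_ [[x0 _ _ sumt] _]] := adm.
have KS : K `<=` S by move=> z /memK [[? ? ?] _]; apply/mem_triangle; split; lra.
have bK := subset_triangle_bounded KS.
have K0 : K !=set0 by exists p1.
have [|q [q1 q2 q3]] := @bary_onto (t + x / 3) (tau + x / 3) (tau + x / 3).
  by lra.
have qK : translate q (dilate x S) `<=` K.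
  move=> z /(mem_copy_bary _ _ x0); rewrite q1 q2 q3 !addrK => -[? ? ?].
  by apply/memK/region_copy => //; exact: bary_sum.
exists K; split.
- split.
    split=> //; last exact: polygon_convex.
    by apply: level_bounded_compact => //; apply: polygon_closed.
  move=> [p KE1]; move: Kp1 Kp2; rewrite KE1 => p1p p2p.
  have [[_ /andP[l0 _] _] _] := adm.
  by move: p11 p21; rewrite p1p p2p; lra.
- rewrite (circumradius_min Kp1 Kp2 Kp3); first by lra.
  by move=> z /KS /mem_triangle [? ? ?]; split; lra.
- apply/eqP; rewrite eq_le; apply/andP; split; last exact: le_inradius bK x0 qK.
  apply: inradius_le => // r s r0 sK.
  have sums := bary_sum s.
  have mem_vertex w1 w2 w3 : w1 + w2 + w3 = 1 -> v1 s - r / 3 <= w1 ->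
      v2 s - r / 3 <= w2 -> v3 s - r / 3 <= w3 -> region k l x t tau w1 w2 w3.
    move=> sumw ? ? ?; have [z [z1 z2 z3]] := bary_onto sumw.
    rewrite -z1 -z2 -z3; apply/memK/sK/mem_copy_bary => //.
    by rewrite z1 z2 z3.
  apply: (@region_copy_le _ k l x t tau r (v1 s - r / 3) (v2 s - r / 3)
    (v3 s - r / 3)) => //; first by lra.
  + by apply: mem_vertex; lra.
  + by apply: mem_vertex; lra.
  + by apply: mem_vertex; lra.
- apply/eqP; rewrite eq_le; apply/andP; split.
    apply: harmonic_diameter_le => // y z.
    move=> /memK [_ [[? ? ? ?] [[? ?] _]]] /memK [_ [[? ? ? ?] [[? ?] _]]].
    by split; lra.
  have [? _ _] := le_harmonic_diameter bK Kp2 Kp1.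
  by lra.
Qed.

End CenteredTriangle.

Theorem corollary5p4 (R : realType) (S : set 'rV[R]_2)
    (S_triangle : triangle S) (S_centered : minkowski_centered S) :
  (forall K : set 'rV[R]_2, convex_bodies_not_point K ->
    [/\ harmonic_diameter K S <= 3 * circumradius K S,
        3 * inradius K S <= harmonic_diameter K S,
        0 <= inradius K S,
        circumradius K S <= 2 / 3 * harmonic_diameter K S
      & 4 / 9 * (harmonic_diameter K S / circumradius K S - 3 / 4)
              * (9 / 4 - harmonic_diameter K S / circumradius K S)
        <= inradius K S / circumradius K S])
  /\
  [set f_HM S K | K in convex_bodies_not_point]
  = [set p : R * R |
      [/\ 2 * p.2 <= 3,
          3 * p.1 <= 2 * p.2,
          0 <= p.1,
          1 <= 4 / 3 * p.2
        & 4 / 9 * (2 * p.2 - 3 / 4) * (9 / 4 - 2 * p.2) <= p.1]].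
Proof.
have [a [b [c [abc_free SE]]]] := S_triangle; subst S.
have abc0 := triangle_vertices_sum abc_free S_centered.
have ab_indep : cross a b != 0.
  move: (row_free_cross abc_free); apply: contra_neq => ab0.
  have -> : c = - (a + b) := third_vertex abc0.
  by move: ab0; rewrite /cross !mxE => ab0; lra.
have ineqs := diagram_inequalities abc0 ab_indep.
split; first by move=> K /ineqs [].
apply/seteqP; split=> [_ [K /ineqs [r0 [D1 D2 D3 D4 D5]] <-]|[x y] /=].
  rewrite /f_HM /=; set D := harmonic_diameter _ _ in D1 D2 D4 D5 *.
  set r := circumradius _ _ in r0 D1 D4 D5 *.
  set i := inradius _ _ in D2 D3 D5 *.
  have r_n0 : r != 0 by rewrite gt_eqF.
  have DE : D / (2 * r) = D / r / 2 by field.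
  rewrite DE; split.
  - have : D / r <= 3 by rewrite ler_pdivrMr.
    by lra.
  - have : i / r <= D / 3 / r by rewrite ler_pM2r ?invr_gt0 //; lra.
    by lra.
  - by rewrite divr_ge0 // ltW.
  - have : 3 / 2 <= D / r by rewrite ler_pdivlMr //; lra.
    by lra.
  - have -> : 2 * (D / r / 2) = D / r by lra.
    exact: D5.
move=> [y1 xy x0 y2 yx].
have w12 : 1 <= 4 / 3 * y <= 2 by apply/andP; split; lra.
have xw : 2 * x <= 4 / 3 * y by lra.
have wx : 1 / 4 - (4 / 3 * y - 1) ^+ 2 <= x by lra.
have [k [l [t [tau [kl adm]]]]] := admissible_exists w12 x0 xw wx.
have [K [KB R1 r1 D1]] := body_with_ratios abc0 ab_indep adm.
exists K => //; rewrite /f_HM R1 r1 D1 kl divr1; congr pair.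
by field.
Qed.
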